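(* Let $\iota : M\times\mathfrak g\to \mathcal Q=\mathcal Q_M\times \mathcal Q_\chi\times\mathcal Q_{\mathfrak g}$ be a differentiable $G\times\widetilde G$-invariant map of the form $$\iota(m,\xi)=(\phi(m),\chi(m,\xi),\alpha(\xi)),$$ let $f:\mathcal Q\to\mathbb R$ be differentiable, and let $F=f\circ\iota$. Then $(m,\xi)\in M\times\mathfrak g$ is a relative critical point of $F$ if and only if $$d_m^*\phi\left(\frac{\partial f}{\partial\phi}(\iota(m,\xi))\right)+d_m^*\chi_\xi\left(\frac{\partial f}{\partial\chi}(\iota(m,\xi))\right)=0,$$ where $\chi_\xi(m):=\chi(m,\xi)$ for all $m\in M$. In particular, $(m,\xi)$ is a relative critical point of $F$ if $$\frac{\partial f}{\partial\phi}(\iota(m,\xi))\in\ker[d_m^*\phi]\qquad\text{and}\qquad \frac{\partial f}{\partial\chi}(\iota(m,\xi))\in\ker[d_m^*\chi_\xi].\qquad(\ast)$$ If $\mathrm{range}[d_m^*\phi]\cap\mathrm{range}[d_m^*\chi_\xi]$ is trivial, then $(\ast)$ is also a necessary condition for $(m,\xi)$ to be a relative critical point of $F$.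
   Context: $M$ is a manifold with a left action of a Lie group $G$ with Lie algebra $\mathfrak g$; another group $\widetilde G$ acts on $\mathfrak g$, and this action commutes with the adjoint action of $G$. The group $G\times\widetilde G$ acts on $M\times\mathfrak g$ by $(g,h)\cdot(m,\xi)=(g\cdot m,\,h\cdot\mathrm{Ad}_g\xi)$, and invariance of a map on $M\times\mathfrak g$ refers to this action. $\mathcal Q_M,\mathcal Q_\chi,\mathcal Q_{\mathfrak g}$ are manifolds, $\phi:M\to\mathcal Q_M$, $\chi:M\times\mathfrak g\to\mathcal Q_\chi$, $\alpha:\mathfrak g\to\mathcal Q_{\mathfrak g}$. A pair $(m,\xi)$ is a relative critical point of $F:M\times\mathfrak g\to\mathbb R$ if $m$ is a critical point of the function $F_\xi:M\to\mathbb R$, $F_\xi(m):=F(m,\xi)$. For a differentiable map $\psi:M\to N$ of manifolds, $d_m\psi:T_mM\to T_{\psi(m)}N$ is its derivative at $m$ and $d_m^*\psi:T^*_{\psi(m)}N\to T^*_mM$ is the dual (transpose) linear map. For $f:\mathcal Q\to\mathbb R$, the partial derivatives $\frac{\partial f}{\partial\phi}(p,x,a)\in T_p^*\mathcal Q_M$ and $\frac{\partial f}{\partial\chi}(p,x,a)\in T_x^*\mathcal Q_\chi$ are defined by $\frac{\partial f}{\partial\phi}(p,x,a)(\delta p)=df(p,x,a)(\delta p,0,0)$ and $\frac{\partial f}{\partial\chi}(p,x,a)(\delta x)=df(p,x,a)(0,\delta x,0)$. *)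

(* Defs.v *)
From HB Require Import structures.
From mathcomp Require Import all_boot all_order all_algebra.
From mathcomp Require Import all_classical all_reals interval_inference.
From mathcomp Require Import topology tvs normedtype landau derive.

Set Implicit Arguments.
Unset Strict Implicit.
Unset Printing Implicit Defensive.

Import Order.TTheory GRing.Theory Num.Theory.
Import numFieldTopology.Exports numFieldNormedType.Exports.

Local Open Scope classical_set_scope.
Local Open Scope ring_scope.

Definition finite_dimensional (R : realType) (E : normedModType R) : Prop :=
  exists n (e : 'I_n -> E), forall v, exists a : 'I_n -> R,
    v = \sum_(i < n) a i *: e i.

(* On an open subset of a finite-dimensional space, a map is C^(k+1) iff it is *)
(* differentiable with all its directional derivatives C^k.                    *)
Fixpoint Ck_on (R : realType) (E F : normedModType R) (k : nat) (U : set E)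
    (f : E -> F) : Prop :=
  match k with
  | 0 => forall x, U x -> {for x, continuous f}
  | k'.+1 => (forall x, U x -> differentiable f x) /\
             (forall v, Ck_on k' U (fun x => 'd f x v))
  end.

Definition smooth_on (R : realType) (E F : normedModType R) (U : set E)
    (f : E -> F) : Prop := forall k, Ck_on k U f.

Record chart (R : realType) (E : normedModType R) (T : topologicalType) :=
  Chart {
    cdom : set T;
    cmap : T -> E;
    cinv : E -> T;
    open_cdom : open cdom;
    open_cimg : open (cmap @` cdom);
    cmapK : forall x, cdom x -> cinv (cmap x) = x;
    cmap_continuous : forall x, cdom x -> {for x, continuous cmap};
    cinv_continuous : forall x, cdom x -> {for cmap x, continuous cinv}
  }.

Definition cimg (R : realType) (E : normedModType R) (T : topologicalType)
  (c : chart E T) : set E := cmap c @` cdom c.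

Definition chart_compatible (R : realType) (E : normedModType R)
    (T : topologicalType) (c d : chart E T) : Prop :=
  smooth_on [set y | cimg c y /\ cdom d (cinv c y)] (cmap d \o cinv c).

(* The smooth structure is given by an atlas indexed by the points of T, the   *)
(* chart of index x being defined around x. Every atlas contains such a family *)
(* and the latter determines the same maximal atlas.                           *)
HB.mixin Record isManifold (R : realType) (E : normedModType R) T
    of Topological T := {
  chart_at : T -> chart E T;
  chart_at_mem : forall x : T, cdom (chart_at x) x;
  chart_at_compatible :
    forall x y : T, chart_compatible (chart_at x) (chart_at y);
  manifold_hausdorff : hausdorff_space T;
  manifold_second_countable : @second_countable T;
  manifold_findim : finite_dimensional E
}.

#[short(type="manifoldType")]
HB.structure Definition Manifold (R : realType) (E : normedModType R) :=
  { T of isManifold R E T & Topological T }.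

Arguments chart_at {R E s} _.

Lemma near_eq_diff (R : realType) (E F : normedModType R) (f g : E -> F) (x : E) :
  (\forall y \near x, f y = g y) -> differentiable f x ->
  differentiable g x /\ 'd g x = 'd f x :> (E -> F).
Proof.
move=> fg df.
have gx : g x = f x by exact: esym (nbhs_singleton fg).
have dgo : g \o shift x = cst (g x) + 'd f x +o_ 0 id.
  apply/eqaddoP => _/posnumP[e].
  have /eqaddoP /(_ e%:num) /(_ _) dfo := diff_locally df.
  have fg0 : \forall h \near 0, f (h + x) = g (h + x).
    by have := fg; rewrite (near_shift 0) subr0; apply.
  near=> h.
  have -> : (g \o shift x - (cst (g x) + 'd f x)) h =
            (f \o shift x - (cst (f x) + 'd f x)) h.
    rewrite /GRing.add /GRing.opp /= gx; congr (_ - _); apply/esym.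
    by near: h.
  by near: h; apply: dfo.
have dE := diff_unique (diff_continuous df) dgo.
split=> //; apply/diff_locallyP; rewrite dE; split=> //.
exact: diff_continuous.
Unshelve. all: by end_near. Qed.

Section Ck_theory.
Context {R : realType}.
Implicit Types E F H : normedModType R.

Lemma Ck_on_subset E F k (U V : set E) (f : E -> F) :
  V `<=` U -> Ck_on k U f -> Ck_on k V f.
Proof.
move=> VU; elim: k f => [|k IH] f /=; first by move=> h x /VU /h.
by move=> [df cf]; split=> [x /VU /df //|v]; exact/IH.
Qed.

Lemma Ck_on_eq E F k (U : set E) (f g : E -> F) : open U ->
  (forall x, U x -> f x = g x) -> Ck_on k U f -> Ck_on k U g.
Proof.
move=> oU; elim: k f g => [|k IH] f g fg /=.
  move=> cf x Ux; have : f @ x --> f x := cf x Ux.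
  rewrite (fg x Ux) => /(cvg_trans _); apply.
  apply: near_eq_cvg; apply: filterS (open_nbhs_nbhs (conj oU Ux)).
  by move=> y /fg.
have nfg x : U x -> \forall y \near x, f y = g y.
  by move=> Ux; apply: filterS (open_nbhs_nbhs (conj oU Ux)) => y /fg.
move=> [df cf]; split=> [x Ux|v].
  by have [] := near_eq_diff (nfg x Ux) (df x Ux).
apply: (IH _ _ _ (cf v)) => x Ux.
by have [_ ->] := near_eq_diff (nfg x Ux) (df x Ux).
Qed.

Lemma Ck_on_cst E F k (U : set E) (c : F) : Ck_on k U (cst c : E -> F).
Proof.
elim: k c => [|k IH] c /=; first by move=> x _; exact: cst_continuous.
split=> [x _|v]; first exact: differentiable_cst.
suff -> : (fun x : E => 'd (cst c : E -> F) x v) = cst 0 by exact: IH.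
by apply/funext => x; rewrite diff_cst.
Qed.

Lemma Ck_on_id E k (U : set E) : Ck_on k U (id : E -> E).
Proof.
case: k => [|k] /=; first by move=> x _; exact: cvg_id.
have dE x : 'd (id : E -> E) x = id :> (E -> E) by rewrite diff_val.
split=> [x _|v]; first exact: ex_diff.
suff -> : (fun x : E => 'd (id : E -> E) x v) = cst v by exact: Ck_on_cst.
by apply/funext => x; rewrite dE.
Qed.

Lemma Ck_on_pair E F H k (U : set E) (f : E -> F) (g : E -> H) : open U ->
  Ck_on k U f -> Ck_on k U g -> Ck_on k U (fun x => (f x, g x)).
Proof.
move=> oU; elim: k f g => [|k IH] f g /=.
  by move=> cf cg x Ux; apply: cvg_pair; [exact: cf|exact: cg].
move=> [df cf] [dg cg]; split=> [x Ux|v].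
  by apply: differentiable_pair; [exact: df|exact: dg].
apply: (Ck_on_eq oU _ (IH _ _ (cf v) (cg v))) => x Ux.
by rewrite diff_pair //; [exact: df|exact: dg].
Qed.

Lemma Ck_on_fst E F H k (U : set E) (W : set (E * F)) (f : E -> H) :
  open W -> (forall p, W p -> U p.1) -> Ck_on k U f -> Ck_on k W (f \o fst).
Proof.
move=> oW WU; elim: k f => [|k IH] f /=.
  by move=> cf p /WU Up; apply: continuous_comp; [exact: cvg_fst|exact: cf].
move=> [df cf].
have dfst (p : E * F) : differentiable (fst : E * F -> E) p.
  by apply: linear_differentiable => q; exact: cvg_fst.
split=> [p /WU Up|v].
  by apply: differentiable_comp; [exact: dfst|exact: df].
apply: (Ck_on_eq oW _ (IH _ (cf v.1))) => p /WU Up.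
rewrite diff_comp //=; last exact: df.
by rewrite diff_lin // => q; exact: cvg_fst.
Qed.

Lemma Ck_on_snd E F H k (U : set F) (W : set (E * F)) (f : F -> H) :
  open W -> (forall p, W p -> U p.2) -> Ck_on k U f -> Ck_on k W (f \o snd).
Proof.
move=> oW WU; elim: k f => [|k IH] f /=.
  by move=> cf p /WU Up; apply: continuous_comp; [exact: cvg_snd|exact: cf].
move=> [df cf].
have dsnd (p : E * F) : differentiable (snd : E * F -> F) p.
  by apply: linear_differentiable => q; exact: cvg_snd.
split=> [p /WU Up|v].
  by apply: differentiable_comp; [exact: dsnd|exact: df].
apply: (Ck_on_eq oW _ (IH _ (cf v.2))) => p /WU Up.
rewrite diff_comp //=; last exact: df.
by rewrite diff_lin // => q; exact: cvg_snd.
Qed.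

End Ck_theory.

Lemma hausdorff_prod (T U : topologicalType) :
  hausdorff_space T -> hausdorff_space U -> hausdorff_space (T * U)%type.
Proof.
move=> hT hU [a b] [c d] clab; congr pair.
- apply: hT => A B Aa Bc.
  have [] := clab (A `*` setT) (B `*` setT).
  + by exists (A, setT) => //; split=> //; exact: filterT.
  + by exists (B, setT) => //; split=> //; exact: filterT.
  + by move=> x [[? _] [? _]]; exists x.1.
- apply: hU => A B Aa Bc.
  have [] := clab (setT `*` A) (setT `*` B).
  + by exists (setT, A) => //; split=> //; exact: filterT.
  + by exists (setT, B) => //; split=> //; exact: filterT.
  + by move=> x [[_ ?] [_ ?]]; exists x.2.
Qed.

Lemma open_setX (T U : topologicalType) (A : set T) (B : set U) :
  open A -> open B -> open (A `*` B).
Proof.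
rewrite !openE => oA oB [x y] [/= /oA Ax /oB By].
by exists (A, B).
Qed.

Lemma second_countable_prod (T U : topologicalType) :
  @second_countable T -> @second_countable U -> @second_countable (T * U)%type.
Proof.
move=> [A cA [oA bA]] [B cB [oB bB]].
exists ((fun p : set T * set U => p.1 `*` p.2) @` (A `*` B)).
  apply: (card_le_trans (card_image_le _ _)); exact: countableX.
split=> [_ [[V W] [/= AV BW] <-]|[x y] S [[P Q] [/= xP yQ] PQS]].
  by apply: open_setX; [exact: oA|exact: oB].
have [V [AV Vx VP]] := bA x _ xP; have [W [BW Wy WQ]] := bB y _ yQ.
exists (V `*` W); first by split=> //; exists (V, W).
by move=> p [/VP ? /WQ ?]; exact: PQS.
Qed.

Lemma finite_dimensional_prod (R : realType) (E F : normedModType R) :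
  finite_dimensional E -> finite_dimensional F ->
  finite_dimensional (E * F)%type.
Proof.
move=> [n [e he]] [m [g hg]].
pose eg (s : 'I_n + 'I_m) : E * F :=
  match s with inl i => (e i, 0) | inr j => (0, g j) end.
exists (n + m)%N, (eg \o @fintype.split n m) => -[v w].
have [a va] := he v; have [b wb] := hg w.
exists (fun i => match fintype.split i with inl i => a i | inr j => b j end).
rewrite big_split_ord /=.
under eq_bigr do rewrite -[lshift m _]/(unsplit (inl _)) unsplitK.
under [X in _ + X]eq_bigr do rewrite -[rshift n _]/(unsplit (inr _)) unsplitK.
have fstS k (h : 'I_k -> E * F) :
    \sum_(i < k) h i = (\sum_(i < k) (h i).1, \sum_(i < k) (h i).2).
  elim/big_rec3: _ => // i x y p _ ->.
  by rewrite -[LHS]/((h i).1 + y, (h i).2 + x).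
rewrite !fstS -[RHS]/(_ + _, _ + _) /=.
rewrite va wb; congr pair.
- by rewrite [X in _ + X]big1 ?addr0 // => i _; rewrite scaler0.
- by rewrite [X in X + _]big1 ?add0r // => i _; rewrite scaler0.
Qed.

Lemma finite_dimensional_regular (R : realType) :
  finite_dimensional (R^o : normedModType R).
Proof.
exists 1, (fun=> 1) => v; exists (fun=> v).
by rewrite big_ord1 [RHS]mulr1.
Qed.

Lemma findim_second_countable (R : realType) (E : normedModType R) :
  finite_dimensional E -> @second_countable E.
Proof.
move=> [n [e he]].
pose c (q : {ffun 'I_n -> rat}) : E := \sum_(i < n) ratr (q i) *: e i.
pose B (p : {ffun 'I_n -> rat} * nat) : set E := ball (c p.1) p.2.+1%:R^-1.
exists (range B).
  by apply: (card_le_trans (card_image_le _ _)); exact: countableP.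
split=> [_ [p _ <-]|x S /nbhs_ballP[_/posnumP[r] rS]].
  by apply: ball_open.
have [//|k] := @ltr_add_invr R 0 (r%:num / 2) _; rewrite add0r => kr.
have [a xa] := he x.
pose M := 1 + \sum_(i < n) `|e i|.
have M0 : 0 < M by rewrite ltr_pwDl // sumr_ge0.
have dlt0 : 0 < k.+1%:R^-1 / M by rewrite divr_gt0.
have hq i : exists q : rat, `|a i - ratr q| < k.+1%:R^-1 / M.
  have [q] := @rat_in_itvoo R (a i - k.+1%:R^-1 / M) (a i) (ltac:(by rewrite gtrBl)).
  rewrite in_itv /= => /andP[q1 q2]; exists q.
  by rewrite ger0_norm ?subr_ge0 ?ltW // ltrBlDl -ltrBlDr.
have [q hq'] := choice hq.
pose qf := [ffun i => q i].
have cx : ball (c qf) k.+1%:R^-1 x.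
  rewrite -ball_normE /= distrC xa /c -sumrB.
  apply: (@le_lt_trans _ _ (\sum_(i < n) (k.+1%:R^-1 / M) * `|e i|)).
    apply: (le_trans (ler_norm_sum _ _ _)); apply: ler_sum => i _.
    by rewrite -scalerBl normrZ ffunE ler_wpM2r // ltW.
  rewrite -mulr_sumr -mulrA gtr_pMr ?invr_gt0 // mulrC ltr_pdivrMr // mul1r.
  by rewrite /M ltrDr.
exists (B (qf, k)); first by split=> //; exists (qf, k).
move=> y /= cy; apply: rS; rewrite [r%:num]splitr.
by apply: (@ball_triangle _ _ (c qf)); [apply: ball_sym|]; apply: le_ball (ltW kr) _ _.
Qed.

Section ProdManifold.
Context (R : realType) (E F : normedModType R).

Section ProdChart.
Context (T U : topologicalType) (c : chart E T) (d : chart F U).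

Let prod_cmap (p : T * U) : E * F := (cmap c p.1, cmap d p.2).
Let prod_cinv (v : E * F) : T * U := (cinv c v.1, cinv d v.2).

Lemma prod_cimgE : prod_cmap @` (cdom c `*` cdom d) = cimg c `*` cimg d.
Proof.
apply/seteqP; split=> [_ [p [p1 p2] <-]|[v w] /= [[x cx <-] [y dy <-]]].
  by split; [exists p.1|exists p.2].
by exists (x, y).
Qed.

Lemma open_prod_cdom : open (cdom c `*` cdom d).
Proof. by apply: open_setX; exact: open_cdom. Qed.

Lemma open_prod_cimg : open (prod_cmap @` (cdom c `*` cdom d)).
Proof. by rewrite prod_cimgE; apply: open_setX; exact: open_cimg. Qed.

Lemma prod_cmapK p : (cdom c `*` cdom d) p -> prod_cinv (prod_cmap p) = p.
Proof. by case: p => x y [cx dy]; rewrite /prod_cinv /= !cmapK. Qed.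

Lemma prod_cmap_continuous p : (cdom c `*` cdom d) p ->
  {for p, continuous prod_cmap}.
Proof.
move=> [cp dp]; apply: cvg_pair.
- by apply: (@continuous_comp _ _ _ fst (cmap c));
    [exact: cvg_fst|exact: cmap_continuous].
- by apply: (@continuous_comp _ _ _ snd (cmap d));
    [exact: cvg_snd|exact: cmap_continuous].
Qed.

Lemma prod_cinv_continuous p : (cdom c `*` cdom d) p ->
  {for prod_cmap p, continuous prod_cinv}.
Proof.
move=> [cp dp]; apply: cvg_pair.
- by apply: (@continuous_comp _ _ _ fst (cinv c));
    [exact: cvg_fst|exact: cinv_continuous].
- by apply: (@continuous_comp _ _ _ snd (cinv d));
    [exact: cvg_snd|exact: cinv_continuous].
Qed.

Definition prod_chart : chart (E * F)%type (T * U)%type :=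
  Chart open_prod_cdom open_prod_cimg prod_cmapK prod_cmap_continuous
    prod_cinv_continuous.

End ProdChart.

Lemma open_overlap (T : topologicalType) (c d : chart E T) :
  open [set y | cimg c y /\ cdom d (cinv c y)].
Proof.
rewrite openE => _ [[x cx <-] /=]; rewrite cmapK // => dx.
apply: filterI.
  by apply: open_nbhs_nbhs; split; [exact: open_cimg|exists x].
have := @cinv_continuous _ _ _ c x cx; apply; rewrite /= cmapK //.
by apply: open_nbhs_nbhs; split => //; exact: open_cdom.
Qed.

End ProdManifold.

Section ProdManifoldInstance.
Context (R : realType) (E F : normedModType R).
Context (M : manifoldType E) (N : manifoldType F).

Let prod_chart_at (p : M * N) := prod_chart (chart_at p.1) (chart_at p.2).

Let prod_chart_at_mem p : cdom (prod_chart_at p) p.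
Proof. by split; exact: chart_at_mem. Qed.

Let prod_chart_at_compatible p q :
  chart_compatible (prod_chart_at p) (prod_chart_at q).
Proof.
move=> k.
have sub1 v : cimg (prod_chart_at p) v /\
    cdom (prod_chart_at q) (cinv (prod_chart_at p) v) ->
    cimg (chart_at p.1) v.1 /\ cdom (chart_at q.1) (cinv (chart_at p.1) v.1).
  by rewrite /cimg [X in X v]prod_cimgE => -[[? ?] [? ?]].
have sub2 v : cimg (prod_chart_at p) v /\
    cdom (prod_chart_at q) (cinv (prod_chart_at p) v) ->
    cimg (chart_at p.2) v.2 /\ cdom (chart_at q.2) (cinv (chart_at p.2) v.2).
  by rewrite /cimg [X in X v]prod_cimgE => -[[? ?] [? ?]].
have oW := open_overlap (prod_chart_at p) (prod_chart_at q).
apply: Ck_on_pair => //.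
- exact: (Ck_on_fst oW sub1 (chart_at_compatible p.1 q.1 k)).
- exact: (Ck_on_snd oW sub2 (chart_at_compatible p.2 q.2 k)).
Qed.

HB.instance Definition _ := isManifold.Build R (E * F)%type (M * N)%type
  prod_chart_at_mem prod_chart_at_compatible
  (hausdorff_prod (@manifold_hausdorff _ _ M) (@manifold_hausdorff _ _ N))
  (second_countable_prod (@manifold_second_countable _ _ M)
     (@manifold_second_countable _ _ N))
  (finite_dimensional_prod (@manifold_findim _ _ M) (@manifold_findim _ _ N)).

End ProdManifoldInstance.

Section VectorSpaceManifold.
Context (R : realType) (E : normedModType R).

Lemma open_img_id : open (id @` [set: E]).
Proof. by rewrite image_id; exact: openT. Qed.

Definition id_chart : chart E E :=
  @Chart R E E setT id id openT open_img_id (fun _ _ => erefl)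
    (fun _ _ => cvg_id) (fun _ _ => cvg_id).

Lemma id_chart_compatible : chart_compatible id_chart id_chart.
Proof. by move=> k; exact: Ck_on_id. Qed.

End VectorSpaceManifold.

HB.instance Definition _ (R : realType) := isManifold.Build R R^o R^o
  (fun=> I : cdom (id_chart R^o) _) (fun _ _ => @id_chart_compatible R R^o)
  (@norm_hausdorff _ R^o)
  (findim_second_countable (finite_dimensional_regular R))
  (finite_dimensional_regular R).

(* The tangent space at x is identified with the model space E through the     *)
(* derivative at x of the chart of index x; derivatives of maps are computed   *)
(* in the charts indexed by the point and by its image. Another choice of      *)
(* indexed charts changes these spaces and derivatives by linear isomorphisms. *)
Definition tangent (R : realType) (E : normedModType R) (M : manifoldType E)
  (x : M) : Type := E.

HB.instance Definition _ (R : realType) (E : normedModType R)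
  (M : manifoldType E) (x : M) := NormedModule.copy (tangent x) E.

Section Derivative.
Context (R : realType) (E F : normedModType R).
Context (M : manifoldType E) (N : manifoldType F).

Definition in_charts (f : M -> N) (x : M) (y : N) : E -> F :=
  cmap (chart_at y) \o f \o cinv (chart_at x).

Definition differentiable_at (f : M -> N) (x : M) : Prop :=
  {for x, continuous f} /\
  differentiable (in_charts f x (f x)) (cmap (chart_at x) x).

Definition differentiable_map (f : M -> N) : Prop :=
  forall x, differentiable_at f x.

Definition smooth_map (f : M -> N) : Prop :=
  continuous f /\
  forall x y, smooth_on
    [set v | cimg (chart_at x) v /\ cdom (chart_at y) (f (cinv (chart_at x) v))]
    (in_charts f x y).

Definition tangent_map (f : M -> N) (x : M) : {linear tangent x -> tangent (f x)} :=
  'd (in_charts f x (f x)) (cmap (chart_at x) x).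

End Derivative.

Definition dual (R : realType) (V : lmodType R) : Type := {linear V -> R^o}.

Section Dual.
Context (R : realType) (V : lmodType R).

HB.instance Definition _ := Choice.copy (dual V) {linear V -> R^o}.

Lemma dual_ext (w w' : dual V) : (forall v, w v = w' v) -> w = w'.
Proof.
case: w w' => [f [[fA] [fZ]]] [g [[gA] [gZ]]] /= /funext fg.
rewrite fg in fA fZ *.
by rewrite (Prop_irrelevance fA gA) (Prop_irrelevance fZ gZ).
Qed.

Let lin (w : dual V) : {linear V -> R^o} := w.
Let add0 : dual V := (\0 : {linear V -> R^o}).
Let addN (w : dual V) : dual V := (\- lin w : {linear V -> R^o}).
Let addD (w w' : dual V) : dual V := (lin w \+ lin w' : {linear V -> R^o}).
Let addZ (a : R) (w : dual V) : dual V := (a \*: lin w : {linear V -> R^o}).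

Fact dual_addA : associative addD.
Proof. by move=> u v w; apply: dual_ext => x; exact: addrA. Qed.
Fact dual_addC : commutative addD.
Proof. by move=> v w; apply: dual_ext => x; exact: addrC. Qed.
Fact dual_add0 : left_id add0 addD.
Proof. by move=> w; apply: dual_ext => x; exact: add0r. Qed.
Fact dual_addN : left_inverse add0 addN addD.
Proof. by move=> w; apply: dual_ext => x; exact: addNr. Qed.

HB.instance Definition _ := GRing.isZmodule.Build (dual V)
  dual_addA dual_addC dual_add0 dual_addN.

Fact dual_scaleA a b (w : dual V) : addZ a (addZ b w) = addZ (a * b) w.
Proof. by apply: dual_ext => x; exact: scalerA. Qed.
Fact dual_scale1 : left_id 1 addZ.
Proof. by move=> w; apply: dual_ext => x; exact: scale1r. Qed.
Fact dual_scaleDr : right_distributive addZ +%R.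
Proof. by move=> a v w; apply: dual_ext => x; exact: scalerDr. Qed.
Fact dual_scaleDl (w : dual V) : {morph addZ^~ w : a b / a + b}.
Proof. by move=> a b; apply: dual_ext => x; exact: scalerDl. Qed.

HB.instance Definition _ := GRing.Zmodule_isLmodule.Build R (dual V)
  dual_scaleA dual_scale1 dual_scaleDr dual_scaleDl.

End Dual.

Section Transpose.
Context (R : realType) (V W : lmodType R) (f : {linear V -> W}).

Definition transpose (w : dual W) : dual V :=
  ((w : {linear W -> R^o}) \o f : {linear V -> R^o}).

Fact transpose_linear : linear transpose.
Proof. by move=> a v w; exact: dual_ext. Qed.

HB.instance Definition _ := GRing.isLinear.Build R (dual W) (dual V) _
  transpose transpose_linear.

End Transpose.

Definition cotangent (R : realType) (E : normedModType R) (M : manifoldType E)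
  (x : M) : Type := dual (tangent x).

HB.instance Definition _ (R : realType) (E : normedModType R)
  (M : manifoldType E) (x : M) := GRing.Lmodule.copy (cotangent x) (dual (tangent x)).

Definition cotangent_map (R : realType) (E F : normedModType R)
    (M : manifoldType E) (N : manifoldType F) (f : M -> N) (x : M) :
    {linear cotangent (f x) -> cotangent x} :=
  transpose (tangent_map f x).

(* The tangent space of R at any point is R.                                   *)
Definition differential (R : realType) (E : normedModType R)
    (M : manifoldType E) (f : M -> R^o) (x : M) : cotangent x :=
  tangent_map f x.

Definition critical_point (R : realType) (E : normedModType R)
    (M : manifoldType E) (f : M -> R^o) (x : M) : Prop :=
  differentiable_at f x /\ differential f x = 0.

Section PartialDerivatives.
Context (R : realType) (E1 E2 E3 : normedModType R).
Context (Q1 : manifoldType E1) (Q2 : manifoldType E2) (Q3 : manifoldType E3).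

(* The chart of index (p, x, a) of a product being the product of the charts   *)
(* of index p, x and a, the tangent space of the product at (p, x, a) is the   *)
(* product of the tangent spaces.                                              *)
Definition prod_tangent (q : Q1 * Q2 * Q3) (u : tangent q.1.1)
  (v : tangent q.1.2) (w : tangent q.2) : tangent q := (u, v, w).

Definition inj1_tangent (q : Q1 * Q2 * Q3) (u : tangent q.1.1) : tangent q :=
  prod_tangent u 0 0.

Definition inj2_tangent (q : Q1 * Q2 * Q3) (v : tangent q.1.2) : tangent q :=
  prod_tangent 0 v 0.

Fact inj1_tangent_linear q : linear (@inj1_tangent q).
Proof.
by move=> a u v; congr (_, _, _); rewrite [RHS]addr0 [RHS]scaler0.
Qed.

Fact inj2_tangent_linear q : linear (@inj2_tangent q).
Proof.
by move=> a u v; congr (_, _, _); rewrite [RHS]addr0 [RHS]scaler0.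
Qed.

HB.instance Definition _ q := GRing.isLinear.Build R (tangent q.1.1) (tangent q)
  _ (@inj1_tangent q) (@inj1_tangent_linear q).

HB.instance Definition _ q := GRing.isLinear.Build R (tangent q.1.2) (tangent q)
  _ (@inj2_tangent q) (@inj2_tangent_linear q).

Definition partial1 (f : Q1 * Q2 * Q3 -> R^o) (q : Q1 * Q2 * Q3) :
    cotangent q.1.1 :=
  transpose (@inj1_tangent q) (differential f q).

Definition partial2 (f : Q1 * Q2 * Q3 -> R^o) (q : Q1 * Q2 * Q3) :
    cotangent q.1.2 :=
  transpose (@inj2_tangent q) (differential f q).

End PartialDerivatives.

HB.mixin Record isLieGroup (R : realType) (E : normedModType R) G
    of Manifold R E G & Group G := {
  mulg_smooth : smooth_map (fun p : G * G => (p.1 * p.2)%g);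
  invg_smooth : smooth_map (fun x : G => (x^-1)%g)
}.

#[short(type="lieGroupType")]
HB.structure Definition LieGroup (R : realType) (E : normedModType R) :=
  { G of isLieGroup R E G & Manifold R E G & Group G }.

Definition lie_algebra (R : realType) (E : normedModType R)
  (G : lieGroupType E) : Type := tangent (1%g : G).

HB.instance Definition _ (R : realType) (E : normedModType R)
  (G : lieGroupType E) := NormedModule.copy (lie_algebra G) E.

HB.instance Definition _ (R : realType) (E : normedModType R)
    (G : lieGroupType E) := isManifold.Build R E (lie_algebra G)
  (fun=> I : cdom (id_chart E) _) (fun _ _ => @id_chart_compatible R E)
  (@norm_hausdorff _ E)
  (findim_second_countable (@manifold_findim _ _ G))
  (@manifold_findim _ _ G).

(* The derivative at 1 of conjugation by g takes values in the tangent space   *)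
(* at g * 1 * g^-1, which is the one at 1.                                     *)
Definition Ad (R : realType) (E : normedModType R) (G : lieGroupType E)
    (g : G) (xi : lie_algebra G) : lie_algebra G :=
  tangent_map (fun x : G => (g * x * g^-1)%g) 1%g xi.

Definition left_action (G : groupType) (X : Type) (act : G -> X -> X) : Prop :=
  (forall x, act 1%g x = x) /\
  (forall g h x, act (g * h)%g x = act g (act h x)).

Definition smooth_action (R : realType) (EG EM : normedModType R)
    (G : lieGroupType EG) (M : manifoldType EM) (act : G -> M -> M) : Prop :=
  left_action act /\ smooth_map (fun p : G * M => act p.1 p.2).

Definition relative_critical_point (R : realType) (EG EM : normedModType R)
    (G : lieGroupType EG) (M : manifoldType EM)
    (F : M * lie_algebra G -> R^o) (z : M * lie_algebra G) : Prop :=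
  critical_point (fun m => F (m, z.2)) z.1.

Section Iota.
Context (R : realType) (EG EM E1 E2 E3 : normedModType R).
Context (G : lieGroupType EG) (M : manifoldType EM).
Context (QM : manifoldType E1) (Qchi : manifoldType E2) (Qg : manifoldType E3).

Definition iota_map (phi : M -> QM) (chi : M * lie_algebra G -> Qchi)
    (alpha : lie_algebra G -> Qg) (z : M * lie_algebra G) : QM * Qchi * Qg :=
  (phi z.1, chi z, alpha z.2).

Definition product_action (Gt : groupType) (actM : G -> M -> M)
    (actg : Gt -> lie_algebra G -> lie_algebra G) (gh : G * Gt)
    (z : M * lie_algebra G) : M * lie_algebra G :=
  (actM gh.1 z.1, actg gh.2 (Ad gh.1 z.2)).

End Iota.

(* Main.v *)
(* The map m' |-> F (m', xi) is f \o h, where h m' = iota (m', xi) has         *)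
(* components phi, chi_xi and a constant. The chain rule in charts therefore   *)
(* gives dF_xi = d phi^* (df/dphi) + d chi_xi^* (df/dchi) at m. If this sum    *)
(* vanishes, d phi^* (df/dphi) lies in the ranges of both d phi^* and          *)
(* d chi_xi^*, hence is 0 when these meet trivially.                           *)

Require Import Defs.
From HB Require Import structures.
From mathcomp Require Import all_boot all_order all_algebra.
From mathcomp Require Import all_classical all_reals interval_inference.
From mathcomp Require Import topology tvs normedtype landau derive.

Set Implicit Arguments.
Unset Strict Implicit.
Unset Printing Implicit Defensive.

Import Order.TTheory GRing.Theory Num.Theory.
Import numFieldTopology.Exports numFieldNormedType.Exports.

Local Open Scope classical_set_scope.
Local Open Scope ring_scope.

Section TangentMap.
Context (R : realType) (E F : normedModType R).
Context (M : manifoldType E) (N : manifoldType F).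

Lemma chart_atK (x : M) : cinv (chart_at x) (cmap (chart_at x) x) = x.
Proof. by rewrite cmapK //; exact: chart_at_mem. Qed.

Lemma near_chart_at_cinvK (x : M) :
  \forall v \near cmap (chart_at x) x,
    cmap (chart_at x) (cinv (chart_at x) v) = v.
Proof.
apply: filterS (open_nbhs_nbhs (conj (open_cimg (chart_at x)) _)).
  by move=> _ [y cy <-]; rewrite cmapK.
by exists x => //; exact: chart_at_mem.
Qed.

(** A derivative depends only on the germ, so a chart expression may be replaced by a simpler map
    [h] that agrees with it only near the point, as charts invert only locally. *)
Lemma differentiable_at_near (f : M -> N) (x : M) (h : E -> F) :
  {for x, continuous f} ->
  (\forall v \near cmap (chart_at x) x, h v = in_charts f x (f x) v) ->
  differentiable h (cmap (chart_at x) x) ->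
  differentiable_at f x /\
  tangent_map f x = 'd h (cmap (chart_at x) x) :> (E -> F).
Proof. by move=> cf hf /(near_eq_diff hf)[df dfE]. Qed.

Lemma tangent_map_cst (y : N) (x : M) v : tangent_map (cst y : M -> N) x v = 0.
Proof.
have cE : in_charts (cst y : M -> N) x y = cst (cmap (chart_at y) y) by [].
by rewrite /tangent_map cE diff_cst.
Qed.

End TangentMap.

Lemma differentiable_at_comp (R : realType) (E F H : normedModType R)
    (M : manifoldType E) (N : manifoldType F) (P : manifoldType H)
    (f : M -> N) (g : N -> P) (x : M) :
  differentiable_at f x -> differentiable_at g (f x) ->
  differentiable_at (g \o f) x /\
  forall v, tangent_map (g \o f) x v = tangent_map g (f x) (tangent_map f x v).
Proof.
move=> [cf df] [cg dg].
pose hf := in_charts f x (f x); pose hg := in_charts g (f x) (g (f x)).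
have hfx : hf (cmap (chart_at x) x) = cmap (chart_at (f x)) (f x).
  by rewrite /hf /in_charts /= chart_atK.
have dg' : differentiable hg (hf (cmap (chart_at x) x)) by rewrite hfx.
(* The middle chart cancels between the expressions of [f] and [g] only where [f] lands in its
   domain; continuity of [f] provides such a neighbourhood. *)
have fdom : \forall v \near cmap (chart_at x) x,
    cdom (chart_at (f x)) (f (cinv (chart_at x) v)).
  have ci := @cinv_continuous _ _ _ _ x (chart_at_mem x).
  apply: (ci (f @^-1` cdom (chart_at (f x)))); rewrite /= chart_atK; apply: cf.
  by apply: open_nbhs_nbhs; split; [exact: open_cdom|exact: chart_at_mem].
have [|||dgf dE] := @differentiable_at_near _ _ _ _ _ (g \o f) x (hg \o hf).
- exact: continuous_comp.
- by apply: filterS fdom => v fv; rewrite /hg /hf /in_charts /= (cmapK fv).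
- exact: differentiable_comp.
split=> // v; rewrite dE diff_comp //=.
by rewrite hfx.
Qed.

Section Products.
Context (R : realType) (E F H : normedModType R).
Context (M : manifoldType E) (N : manifoldType F) (P : manifoldType H).

Lemma differentiable_at_pair_cst (y : N) (x : M) :
  differentiable_at (fun x' : M => (x', y)) x.
Proof.
have [|||//] := @differentiable_at_near _ _ _ _ _ (fun x' : M => (x', y)) x
  (fun v => (v, cmap (chart_at y) y)).
- by apply: cvg_pair; [exact: cvg_id|exact: cvg_cst].
- apply: filterS (near_chart_at_cinvK x) => v vK.
  by rewrite -[RHS]/(cmap _ (cinv _ v), _) vK.
- by apply: differentiable_pair; [exact: ex_diff|exact: differentiable_cst].
Qed.

Lemma differentiable_at_fst (f : M -> N * P) (x : M) :
  differentiable_at f x ->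
  differentiable_at (fst \o f) x /\
  forall v, tangent_map (fst \o f) x v = (tangent_map f x v).1.
Proof.
move=> [cf df].
have fstC (p : F * H) : {for p, continuous (fst : F * H -> F)}.
  exact: cvg_fst.
have dfst (p : F * H) : differentiable (fst : F * H -> F) p.
  exact: linear_differentiable.
(* The charts of a product being product charts, fst and snd are linear there. *)
have fE : in_charts (fst \o f) x (f x).1 = fst \o in_charts f x (f x) by [].
split; first split.
- by apply: continuous_comp => //; exact: cvg_fst.
- by rewrite fE; exact: differentiable_comp.
- by move=> v; rewrite /tangent_map fE diff_comp //= diff_lin.
Qed.

Lemma differentiable_at_snd (f : M -> N * P) (x : M) :
  differentiable_at f x ->
  differentiable_at (snd \o f) x /\
  forall v, tangent_map (snd \o f) x v = (tangent_map f x v).2.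
Proof.
move=> [cf df].
have sndC (p : F * H) : {for p, continuous (snd : F * H -> H)}.
  exact: cvg_snd.
have dsnd (p : F * H) : differentiable (snd : F * H -> H) p.
  exact: linear_differentiable.
have fE : in_charts (snd \o f) x (f x).2 = snd \o in_charts f x (f x) by [].
split; first split.
- by apply: continuous_comp => //; exact: cvg_snd.
- by rewrite fE; exact: differentiable_comp.
- by move=> v; rewrite /tangent_map fE diff_comp //= diff_lin.
Qed.

End Products.

Theorem proposition5 (R : realType) (EG EM E1 E2 E3 : normedModType R)
    (G : lieGroupType EG) (M : manifoldType EM) (Gt : groupType)
    (QM : manifoldType E1) (Qchi : manifoldType E2) (Qg : manifoldType E3)
    (actM : G -> M -> M) (actg : Gt -> lie_algebra G -> lie_algebra G)
    (phi : M -> QM) (chi : M * lie_algebra G -> Qchi)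
    (alpha : lie_algebra G -> Qg) (f : QM * Qchi * Qg -> R^o)
    (actM_smooth : smooth_action actM)
    (actg_action : left_action actg)
    (actg_Ad : forall (g : G) (h : Gt) (xi : lie_algebra G),
      actg h (Ad g xi) = Ad g (actg h xi))
    (iota_diff : differentiable_map (iota_map phi chi alpha))
    (iota_inv : forall (gh : G * Gt) (z : M * lie_algebra G),
      iota_map phi chi alpha (product_action actM actg gh z) =
      iota_map phi chi alpha z)
    (f_diff : differentiable_map f) :
  let iota := iota_map phi chi alpha in
  let F := fun z : M * lie_algebra G => f (iota z) : R^o in
  forall (m : M) (xi : lie_algebra G),
  let chi_xi := fun m' : M => chi (m', xi) in
  let df_dphi : cotangent (phi m) := partial1 f (iota (m, xi)) in
  let df_dchi : cotangent (chi_xi m) := partial2 f (iota (m, xi)) in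
  let star := cotangent_map phi m df_dphi = 0 /\
              cotangent_map chi_xi m df_dchi = 0 in
  [/\ relative_critical_point F (m, xi) <->
        cotangent_map phi m df_dphi + cotangent_map chi_xi m df_dchi = 0,
      star -> relative_critical_point F (m, xi) &
      range (cotangent_map phi m) `&` range (cotangent_map chi_xi m) = [set 0] ->
        relative_critical_point F (m, xi) -> star].
Proof.
move=> iota F m xi chi_xi df_dphi df_dchi star.
pose h (m' : M) := iota (m', xi).
have dh : differentiable_at h m.
  by have [] := differentiable_at_comp (differentiable_at_pair_cst xi m)
    (iota_diff (m, xi)).
have [dF FE] := differentiable_at_comp (f := h) dh (f_diff (h m)).
have [dpc pcE] := differentiable_at_fst dh.
have [_ phiE] := differentiable_at_fst dpc.
have [_ chiE] := differentiable_at_snd dpc.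
have [_ alphaE] := differentiable_at_snd dh.
have hE v : tangent_map h m v =
    @inj1_tangent _ _ _ _ _ _ _ (h m) (tangent_map phi m v) +
    @inj2_tangent _ _ _ _ _ _ _ (h m) (tangent_map chi_xi m v).
  have -> : tangent_map phi m v = (tangent_map h m v).1.1.
    by rewrite -pcE -phiE.
  have -> : tangent_map chi_xi m v = (tangent_map h m v).1.2.
    by rewrite -pcE -chiE.
  (* The last component of [h] is the constant [alpha xi], so [snd \o h] is convertible to a
     constant map and the third component of the derivative is 0. *)
  have := tangent_map_cst (alpha xi) v.
  rewrite -[LHS]/(tangent_map (snd \o h) m v) alphaE.
  case: (tangent_map h m v) => -[u w] a /= ->.
  by congr (_, _, _); rewrite [RHS](addr0, add0r).
have dFE : differential (fun m' => F (m', xi)) m =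
    cotangent_map phi m df_dphi + cotangent_map chi_xi m df_dchi.
  apply: dual_ext => v.
  by rewrite [LHS]FE hE linearD.
have crit : relative_critical_point F (m, xi) <->
    cotangent_map phi m df_dphi + cotangent_map chi_xi m df_dchi = 0.
  (* A critical point also requires differentiability, supplied by [dF]. *)
  by rewrite -dFE; split=> [[]|].
split=> // [[phi0 chi0]|rI /crit sum0].
  by apply/crit; rewrite phi0 chi0 addr0.
have phi0 : cotangent_map phi m df_dphi = 0.
  suff : (range (cotangent_map phi m) `&` range (cotangent_map chi_xi m))
    (cotangent_map phi m df_dphi) by rewrite rI.
  split; first by exists df_dphi.
  (* As the sum vanishes, the phi-term is minus the chi-term, hence the image of [- df_dchi]. *)
  by exists (- df_dchi) => //; rewrite linearN; apply: addr0_eq; rewrite addrC.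
by split=> //; move: sum0; rewrite phi0 add0r.
Qed.
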